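(* Let $f\in\mathbb{R}[x,y]$ be a square-free polynomial defining a curve that is neither a union of parallel lines nor a union of concentric circles, and assume that $\triangle^{\ell}f=x$ for some integer $\ell$. Let $k\le \ell$ be the smallest natural number such that $\triangle^kf=p(x)$ depends only on $x$, and let $\widehat f=\triangle^{k-1}f$. Let $\tilde p(x)\in\mathbb{R}[x]$ be the polynomial with $\tilde p''(x)=p(x)$ and $\tilde p(0)=\tilde p'(0)=0$, and let $h(x,y)=\widehat f(x,y)-\tilde p(x)$. Then $\mathbf{Symm}(f)\subset\mathbf{Symm}(h)$.
   Context: $\triangle f=\partial_x^2 f+\partial_y^2 f$ is the Laplacian, and $\triangle^j$ denotes its $j$-fold iterate. Since the curve $f=0$ is not a union of parallel lines, $k\geq1$, so $\widehat f$ is well defined, and $\widehat f$ depends on $y$. For a polynomial $f\in\mathbb{R}[x,y]$, $\mathbf{Symm}(f)$ is the set of isometries $\phi$ of the plane (maps $X\mapsto AX+b$ with $A$ a real orthogonal $2\times2$ matrix, $b\in\mathbb{R}^2$) such that $f\circ\phi=\lambda f$ for some constant $\lambda\ne0$. Curves are considered as zero sets in $\mathbb{C}^2$. *)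

(* Defs.v *)
From HB Require Import structures.
From mathcomp Require Import all_boot all_order all_algebra.
From mathcomp Require Import reals complex mpoly.

Set Implicit Arguments.
Unset Strict Implicit.
Unset Printing Implicit Defensive.

Import GRing.Theory.
Local Open Scope ring_scope.

(* In {mpoly K[2]}, x is the variable 'X_ord0 and y is 'X_ord_max; points of
   the plane are column vectors whose entries 0 and 1 are x and y. *)

Definition peval (K : comNzRingType) (f : {mpoly K[2]}) (P : 'cV[K]_2) : K :=
  f.@[fun i => P i 0].

Definition laplacian (R : realType) (f : {mpoly R[2]}) : {mpoly R[2]} :=
  f^`M(ord0)^`M(ord0) + f^`M(ord_max)^`M(ord_max).

(* [horner_alg 'X_ord0] substitutes x for the variable of a univariate
   polynomial, i.e. it is the embedding of R[x] into R[x, y]. *)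
Definition poly_in_x (R : realType) (p : {poly R}) : {mpoly R[2]} :=
  horner_alg ('X_ord0 : {mpoly R[2]}) p.

(* A unit of R[x, y] is a nonzero constant. The definition rules out f = 0. *)
Definition square_free (R : realType) (f : {mpoly R[2]}) : Prop :=
  forall g q : {mpoly R[2]}, f = q * g ^+ 2 -> g \is a GRing.unit.

Definition complex_curve (R : realType) (f : {mpoly R[2]}) (P : 'cV[R[i]]_2) :
    Prop :=
  peval (map_mpoly (real_complex R) f) P = 0.

(* The lines are a x + b y = c, with c ranging over the finite sequence s. *)
Definition union_parallel_lines (R : realType) (C : 'cV[R[i]]_2 -> Prop) :
    Prop :=
  exists (a b : R[i]) (s : seq R[i]), (a, b) <> (0, 0) /\
    forall P, C P <-> exists2 c, c \in s & a * P ord0 0 + b * P ord_max 0 = c.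

(* The circles are (x - a)^2 + (y - b)^2 = c, with c ranging over the finite
   sequence s. As these are circles of the complex plane C^2, the squared
   radius c is any complex number, so that imaginary circles and the
   degenerate circle c = 0 (two isotropic lines) are included. *)
Definition union_concentric_circles (R : realType)
    (C : 'cV[R[i]]_2 -> Prop) : Prop :=
  exists (a b : R[i]) (s : seq R[i]),
    forall P, C P <-> exists2 c, c \in s &
      (P ord0 0 - a) ^+ 2 + (P ord_max 0 - b) ^+ 2 = c.

Definition plane_isometry (R : realType) (phi : 'cV[R]_2 -> 'cV[R]_2) : Prop :=
  exists (A : 'M[R]_2) (b : 'cV[R]_2),
    A^T *m A = 1%:M /\ forall X, phi X = A *m X + b.

Definition Symm (R : realType) (f : {mpoly R[2]})
    (phi : 'cV[R]_2 -> 'cV[R]_2) : Prop :=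
  plane_isometry phi /\
  exists2 lambda : R, lambda != 0 &
    forall X, peval f (phi X) = lambda * peval f X.

(* Main.v *)
Require Import Defs.
From mathcomp Require Import all_boot all_order all_algebra.
From mathcomp Require Import reals complex mpoly.
From mathcomp Require Import ring.

Set Implicit Arguments.
Unset Strict Implicit.
Unset Printing Implicit Defensive.

Import GRing.Theory Num.Theory.
Local Open Scope ring_scope.

(** The Laplacian commutes with isometries, so a symmetry [phi] of [f] with
    factor [lambda] is a symmetry, with the same factor, of every iterated
    Laplacian of [f]. For the iterate [x] this reads [x o phi = lambda x], and
    orthogonality gives [lambda^2 = 1]. Applied to [p] it gives
    [p (lambda x) = lambda p x], which the double primitive vanishing to second
    order at [0] inherits. Hence both terms of [h] are multiplied by
    [lambda]. *)

(** A nonzero difference would have the roots 0, 1, ..., size - 1, distinct in characteristic zero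
    and one more than its degree allows. *)
Lemma polyP_horner (R : numDomainType) (p q : {poly R}) :
  (forall t, p.[t] = q.[t]) -> p = q.
Proof.
move=> pq; apply/eqP; rewrite -subr_eq0; apply/negPn/negP => nz.
pose s : seq R := [seq i%:R | i <- iota 0 (size (p - q))].
have us : uniq s.
  by rewrite map_inj_uniq ?iota_uniq // => i j /eqP; rewrite eqr_nat => /eqP.
have rs : all (root (p - q)) s.
  by apply/allP => t _; rewrite rootE hornerD hornerN pq subrr.
by have := max_poly_roots nz rs us; rewrite size_map size_iota ltnn.
Qed.

Lemma deriv_eq0_eq0 (R : numDomainType) (q : {poly R}) :
  q^`() = 0 -> q.[0] = 0 -> q = 0.
Proof.
move=> dq q0; apply/polyP => -[|i]; first by rewrite -horner_coef0 q0 coef0.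
have /eqP := congr1 (fun r : {poly R} => r`_i) dq.
by rewrite coef_deriv coef0 mulrn_eq0 /= => /eqP ->; rewrite coef0.
Qed.

(** Along a line, directional derivatives become formal derivatives of a univariate polynomial. *)
Definition restrict_line (R : comNzRingType) (n : nat) (v u : 'I_n -> R)
    (f : {mpoly R[n]}) : {poly R} :=
  mmap polyC (fun i => (v i)%:P + u i *: 'X) f.

Lemma horner_restrict_line (R : comNzRingType) (n : nat) (v u : 'I_n -> R)
    (f : {mpoly R[n]}) t :
  (restrict_line v u f).[t] = f.@[fun i => v i + u i * t].
Proof.
rewrite /restrict_line mevalE /mmap horner_sum; apply: eq_bigr => m _.
rewrite hornerCM; congr (_ * _); rewrite /mmap1 horner_prod; apply: eq_bigr => i _.
by rewrite horner_exp hornerD hornerC hornerZ hornerX.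
Qed.

(** Chain rule: by linearity and the Leibniz rule, the identity passes to sums and products, so
    constants and variables suffice. *)
Lemma deriv_restrict_line (R : comNzRingType) (n : nat) (v u : 'I_n -> R)
    (f : {mpoly R[n]}) :
  (restrict_line v u f)^`() = \sum_i u i *: restrict_line v u f^`M(i).
Proof.
rewrite /restrict_line; set g := fun i : 'I_n => _.
pose L : {mpoly R[n]} -> {poly R} := mmap polyC g.
pose good f := (L f)^`() = \sum_i u i *: L f^`M(i).
have LD p q : L (p + q) = L p + L q by exact: raddfD.
have LM p q : L (p * q) = L p * L q by exact: (rmorphM (mmap polyC g)).
have LC c : L c%:MP = c%:P by rewrite /L mmapC.
have LX i : L 'X_i = g i by rewrite /L mmapX mmap1U.
have gC c : good c%:MP.
  rewrite /good LC derivC big1 // => i _.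
  by rewrite mderivC -mpolyC0 LC polyC0 scaler0.
have gD p q : good p -> good q -> good (p + q).
  rewrite /good LD derivD => -> ->; rewrite -big_split; apply: eq_bigr => i _ /=.
  by rewrite mderivD LD scalerDr.
have gM p q : good p -> good q -> good (p * q).
  rewrite /good LM derivM => -> ->; rewrite mulr_suml mulr_sumr -big_split.
  apply: eq_bigr => i _ /=.
  by rewrite mderivM LD !LM scalerDr -scalerAl -scalerAr.
have gX i : good 'X_i.
  (* [mderivX] leaves the monomial with exponent [U_(i) - U_(i)], which has to be recognised as
     1. *)
  have UU : (U_(i) - U_(i) = 0 :> 'X_{1..n})%MM by rewrite -{1}[U_(i)%MM]add0m addmK.
  rewrite /good LX /g derivD derivC add0r derivZ derivX (bigD1 i) //= big1 => [|j ji].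
    by rewrite mderivX mnm1E eqxx scale1r UU mpolyX0 LC addr0.
  by rewrite mderivX mnm1E eq_sym (negPf ji) scale0r -mpolyC0 LC scaler0.
rewrite -/(good f) (mpolyE f); elim/big_ind: _ => [|p q|m _].
- by rewrite -mpolyC0.
- exact: gD.
rewrite -mul_mpolyC; apply/gM => //; rewrite mpolyXE_id.
elim/big_ind: _ => [|p q|i _]; first by rewrite -mpolyC1.
  exact: gM.
by elim: (m i) => [|d IH]; rewrite ?expr0 -?mpolyC1 // exprS; apply/gM.
Qed.

(** This is the Hessian quadratic form at [v]; summed over an orthonormal basis of directions [u],
    it gives the Laplacian. *)
Lemma deriv2_restrict_line (R : comNzRingType) (n : nat) (v u : 'I_n -> R)
    (f : {mpoly R[n]}) :
  (restrict_line v u f)^`()^`().[0]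
  = \sum_i \sum_j u i * u j * f^`M(i)^`M(j).@[v].
Proof.
rewrite deriv_restrict_line raddf_sum horner_sum; apply: eq_bigr => i _.
rewrite /= derivZ deriv_restrict_line hornerZ horner_sum mulr_sumr.
apply: eq_bigr => j _; rewrite hornerZ mulrA horner_restrict_line.
by congr (_ * _); apply: meval_eq => m; rewrite mulr0 addr0.
Qed.

Lemma sum_ord2 (V : nmodType) (F : 'I_2 -> V) :
  \sum_i F i = F ord0 + F ord_max.
Proof.
by rewrite big_ord_recl big_ord1; congr (_ + F _); apply: val_inj.
Qed.

(** The Laplacian is the trace of the Hessian, computed at [X] in the standard basis and at the
    image point in the orthonormal basis of columns of [A]. *)
Lemma laplacian_semi_invariant (R : realType) (f : {mpoly R[2]}) (A : 'M[R]_2)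
    (b : 'cV[R]_2) (c : R) :
  A^T *m A = 1%:M ->
  (forall X, peval f (A *m X + b) = c * peval f X) ->
  forall X, peval (laplacian f) (A *m X + b) = c * peval (laplacian f) X.
Proof.
move=> /mulmx1C AAT fA X; set Y := A *m X + b.
pose e j : 'I_2 -> R := fun i => (i == j)%:R.
(* The isometry carries the line through [X] along the [j]-th basis vector to the line through [Y]
   along the [j]-th column of [A]. *)
have lines j : restrict_line (fun i => Y i 0) (fun i => A i j) f
             = c *: restrict_line (fun i => X i 0) (e j) f.
  apply: polyP_horner => t; rewrite hornerZ !horner_restrict_line.
  have := fA (X + t *: delta_mx j 0); rewrite /peval => fAj.
  transitivity (f.@[fun i => (A *m (X + t *: delta_mx j 0) + b) i 0]).
    apply: meval_eq => i.
    rewrite mulmxDr -scalemxAr -colE !mxE; ring.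
  rewrite fAj; congr (_ * _); apply: meval_eq => i.
  by rewrite !mxE andbT mulrC.
have dlines j := congr1 (fun q : {poly R} => q^`()^`().[0]) (lines j).
have {}AAT i j : A i ord0 * A j ord0 + A i ord_max * A j ord_max = (i == j)%:R.
  by have /matrixP/(_ i j) := AAT; rewrite !mxE sum_ord2 !mxE.
have := dlines ord_max; have := dlines ord0.
rewrite !derivZ !hornerZ !deriv2_restrict_line !sum_ord2 /e /=.
rewrite /laplacian /peval.
set g := fun i => Y i 0; set g' := fun i => X i 0.
rewrite !mevalD.
have := AAT ord_max ord_max; have := AAT ord0 ord_max; have := AAT ord0 ord0.
move: (A ord0 ord0) (A ord0 ord_max) (A ord_max ord0) (A ord_max ord_max) => a00 a01 a10 a11 /=.
rewrite !(mul1r, mul0r, add0r, addr0) => r00 r01 r11 E0 E1.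
rewrite mulrDr -E0 -E1.
set G00 := f^`M(ord0)^`M(ord0).@[g]; set G10 := f^`M(ord_max)^`M(ord0).@[g].
set G01 := f^`M(ord0)^`M(ord_max).@[g]; set G11 := f^`M(ord_max)^`M(ord_max).@[g].
(* Grouped by second partials, the coefficients are the entries of [A *m A^T], so the mixed terms
   vanish. *)
transitivity ((a00 * a00 + a01 * a01) * G00 + (a00 * a10 + a01 * a11) * (G01 + G10)
  + (a10 * a10 + a11 * a11) * G11); last by ring.
by rewrite r00 r01 r11 !mul1r mul0r addr0.
Qed.

Lemma iter_laplacian_semi_invariant (R : realType) (f : {mpoly R[2]})
    (A : 'M[R]_2) (b : 'cV[R]_2) (c : R) (j : nat) :
  A^T *m A = 1%:M ->
  (forall X, peval f (A *m X + b) = c * peval f X) ->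
  forall X, peval (iter j (@laplacian R) f) (A *m X + b)
            = c * peval (iter j (@laplacian R) f) X.
Proof.
by move=> orthA fA; elim: j => [//|j IH]; apply: laplacian_semi_invariant.
Qed.

Lemma peval_poly_in_x (R : realType) (q : {poly R}) (X : 'cV[R]_2) :
  peval (poly_in_x q) X = q.[X ord0 0].
Proof.
rewrite /peval /poly_in_x; elim/poly_ind: q => [|q c IH].
  by rewrite rmorph0 meval0 horner0.
rewrite rmorphD rmorphM /= horner_algX horner_algC mevalD mevalM IH mevalXU.
by rewrite mevalZ meval1 mulr1 hornerMXaddC.
Qed.

(** The defect [r] has second derivative [(c ^+ 2 - 1) * c] times that of [q], hence zero, and both
    [r] and its derivative vanish at 0. *)
Lemma double_primitive_semi_invariant (R : numDomainType) (q : {poly R}) (c : R) :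
  c ^+ 2 = 1 -> q.[0] = 0 -> q^`().[0] = 0 ->
  (forall t, q^`(2).[c * t] = c * q^`(2).[t]) ->
  forall t, q.[c * t] = c * q.[t].
Proof.
move=> c2 q0 dq0 ddq t.
pose r := q \Po (c *: 'X) - c *: q.
have dr : r^`() = c *: (q^`() \Po (c *: 'X)) - c *: q^`().
  by rewrite derivB deriv_comp !derivZ derivX -scalerAr mulr1.
have rE s : r.[s] = q.[c * s] - c * q.[s].
  by rewrite /r hornerD hornerN horner_comp !hornerZ hornerX.
suff r0 : r = 0 by apply/eqP; rewrite -subr_eq0 -rE r0 horner0.
apply: deriv_eq0_eq0; last by rewrite rE mulr0 q0 mulr0 subrr.
apply: deriv_eq0_eq0; last first.
  by rewrite dr hornerD hornerN !hornerZ horner_comp hornerZ hornerX mulr0 dq0 mulr0 subrr.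
apply: polyP_horner => s; rewrite horner0 dr derivB !derivZ deriv_comp derivZ derivX.
rewrite hornerD hornerN !hornerZ hornerM horner_comp !hornerZ hornerC hornerX.
have := ddq s; rewrite /derivn /= => ->.
rewrite mulr1 [_ * c]mulrC mulrA mulrA -expr2 c2; ring.
Qed.

Theorem proposition23 (R : realType) (f : {mpoly R[2]}) (l k : nat)
    (p ptilde : {poly R}) (fhat h : {mpoly R[2]})
    (f_sqfree : square_free f)
    (f_nonconstant : (1 < msize f)%N)
    (f_not_lines : ~ union_parallel_lines (complex_curve f))
    (f_not_circles : ~ union_concentric_circles (complex_curve f))
    (f_lap : iter l (@laplacian R) f = 'X_ord0)
    (k_le_l : (k <= l)%N)
    (k_p : iter k (@laplacian R) f = poly_in_x p)
    (k_min : forall j, (j < k)%N ->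
       ~ exists q : {poly R}, iter j (@laplacian R) f = poly_in_x q)
    (fhat_def : fhat = iter k.-1 (@laplacian R) f)
    (ptilde_deriv2 : ptilde^`(2) = p)
    (ptilde_0 : ptilde.[0] = 0)
    (ptilde_deriv_0 : ptilde^`().[0] = 0)
    (h_def : h = fhat - poly_in_x ptilde) :
  forall phi : 'cV[R]_2 -> 'cV[R]_2, Symm f phi -> Symm h phi.
Proof.
move=> phi [[A [b [orthA phiE]]] [c c_neq0 fphi]].
have fA X : peval f (A *m X + b) = c * peval f X by rewrite -phiE.
have xA X : (A *m X + b) ord0 0 = c * X ord0 0.
  have := iter_laplacian_semi_invariant l orthA fA X.
  by rewrite f_lap /peval !mevalXU.
have xE (X : 'cV[R]_2) : A ord0 ord0 * X ord0 0 + A ord0 ord_max * X ord_max 0 + b ord0 0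
            = c * X ord0 0.
  by rewrite -xA !mxE sum_ord2.
(* Evaluating [xE] at the origin and at the two basis vectors shows that the first row of [A] is
   [(c, 0)]; having norm 1, it gives [c ^+ 2 = 1]. *)
have b0 : b ord0 0 = 0 by have := xE 0; rewrite !mxE !mulr0 !add0r.
have A00 : A ord0 ord0 = c.
  by have := xE (delta_mx ord0 0); rewrite !mxE b0 /= !mulr1 mulr0 !addr0.
have A01 : A ord0 ord_max = 0.
  by have := xE (delta_mx ord_max 0); rewrite !mxE b0 /= mulr1 !mulr0 add0r addr0.
have c2 : c ^+ 2 = 1.
  have /matrixP/(_ ord0 ord0) := mulmx1C orthA.
  by rewrite !mxE sum_ord2 !mxE A00 A01 mulr0 addr0 expr2.
split; first by exists A, b.
exists c => // X; rewrite phiE h_def fhat_def /peval !mevalB -!/(peval _ _).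
rewrite (iter_laplacian_semi_invariant _ orthA fA) !peval_poly_in_x xA mulrBr.
congr (_ - _); apply: double_primitive_semi_invariant => // t.
rewrite ptilde_deriv2.
(* Only the first coordinate matters here, so any point with first coordinate [t] will do. *)
have := iter_laplacian_semi_invariant k orthA fA (const_mx t).
by rewrite k_p !peval_poly_in_x xA !mxE.
Qed.
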